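(* Let $\mathcal{H}$ be a real Hilbert space and let $\mathcal{M}:\mathcal{H}\to\mathcal{H}$ be a linear, bounded, self-adjoint and positive semidefinite operator. Let $T:\mathcal{H}\to\mathcal{H}$ be $\mathcal{M}$-nonexpansive and $\mathcal{M}$-to-norm $L$-Lipschitz continuous, with $\operatorname{Fix}(T)$ nonempty, closed and convex. Let $\{x^k\}$ be the sequence generated by the PHA iteration for $T$ from an initial point $x^0\in\mathcal{H}$, and suppose that $\omega_w(x^k)\subseteq\operatorname{Fix}(T)$. Then $\{x^k\}$ converges strongly to a fixed point of $T$.
   Context: Notation: $\langle x,y\rangle_{\mathcal{M}}=\langle \mathcal{M}x,y\rangle$ and $\|x\|_{\mathcal{M}}=\sqrt{\langle x,x\rangle_{\mathcal{M}}}$ (a seminorm). $\operatorname{Fix}(T)=\{x\in\mathcal{H}:Tx=x\}$. $\omega_w(x^k)$ is the set of all weak limits of subsequences of $\{x^k\}$. $T$ is $\mathcal{M}$-nonexpansive if $\|Tx-Ty\|_{\mathcal{M}}\le\|x-y\|_{\mathcal{M}}$ for all $x,y\in\mathcal{H}$. $T$ is $\mathcal{M}$-to-norm $L$-Lipschitz continuous if $\|Tx-Ty\|\le L\|x-y\|_{\mathcal{M}}$ for all $x,y\in\mathcal{H}$. PHA iteration (preconditioned Halpern iteration with adaptive anchoring parameters): given $x^0\in\mathcal{H}$, for $k=1,2,\dots$ set $$x^k=\frac{1}{\varphi_k+1}x^0+\frac{\varphi_k}{\varphi_k+1}Tx^{k-1},\qquad \varphi_k=\frac{2\langle x^{k-1}-Tx^{k-1},\,x^0-x^{k-1}\rangle_{\mathcal{M}}}{\|x^{k-1}-Tx^{k-1}\|_{\mathcal{M}}^2}+1.$$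 It is assumed that $\|x^{k-1}-Tx^{k-1}\|_{\mathcal{M}}\neq 0$ for every $k\ge1$, so that all $\varphi_k$ are defined and the iteration produces an infinite sequence. *)

(* Defs.v *)
From HB Require Import structures.
From mathcomp Require Import all_boot all_order all_algebra sesquilinear.
From mathcomp Require Import all_classical all_reals all_analysis.
Import Order.TTheory GRing.Theory Num.Theory.
Import numFieldNormedType.Exports.

Set Implicit Arguments.
Unset Strict Implicit.
Unset Printing Implicit Defensive.

Local Open Scope classical_set_scope.
Local Open Scope ring_scope.

(* For theta = idfun, {dot H for theta} is the type of symmetric, positive
   definite bilinear forms on H. *)
HB.mixin Record NormedModule_isPreHilbert (R : realType) H
    & NormedModule R H := {
  inner : {dot H for (@idfun R)} ;
  norm_inner : forall x : H, `|x| = Num.sqrt (inner x x)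
}.

#[short(type="hilbertType")]
HB.structure Definition Hilbert (R : realType) :=
  {H of CompleteNormedModule R H & NormedModule_isPreHilbert R H}.

Section defs.
Context {R : realType} {H : hilbertType R}.
Implicit Types (M T : H -> H) (x : H^nat).

Definition bounded_operator M := exists C : R, forall u, `|M u| <= C * `|u|.

Definition self_adjoint M := forall u v, inner (M u) v = inner u (M v).

Definition positive_semidefinite M := forall u, 0 <= inner (M u) u.

Definition Mdot M (u v : H) : R := inner (M u) v.

Definition Mnorm M (u : H) : R := Num.sqrt (Mdot M u u).

Definition Mnonexpansive M T :=
  forall u v, Mnorm M (T u - T v) <= Mnorm M (u - v).

Definition Mto_norm_lipschitz M (L : R) T :=
  forall u v, `|T u - T v| <= L * Mnorm M (u - v).

Definition Fix T : set H := [set u | T u = u].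

Definition weak_cvg x (l : H) :=
  forall v : H, (fun n => inner (x n) v) @ \oo --> inner l v.

Definition weak_cluster_set x : set H :=
  [set l | exists2 f : nat -> nat, increasing_seq f & weak_cvg (x \o f) l].

(* Meaningful only for k >= 1: at k = 0 the truncated predecessor makes
   x k.-1 equal to x 0. *)
Definition PHA_phi M T x (k : nat) : R :=
  let r := x k.-1 - T (x k.-1) in
  2 * Mdot M r (x 0%N - x k.-1) / Mnorm M r ^+ 2 + 1.

Definition PHA_sequence M T (x0 : H) x :=
  x 0%N = x0 /\
  forall k, (1 <= k)%N ->
    let phi := PHA_phi M T x k in
    x k = (1 / (phi + 1)) *: x0 + (phi / (phi + 1)) *: T (x k.-1).

End defs.

(* Main.v *)
Require Import Defs.
From mathcomp Require Import all_boot all_order all_algebra sesquilinear.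
From mathcomp Require Import all_classical all_reals all_analysis.
From mathcomp Require Import ring lra.
Import Order.TTheory GRing.Theory Num.Theory.
Import numFieldNormedType.Exports.

(** The iteration is an anchored one, [x n.+1 = T (x n) + c n *: (x0 - T (x n))]
    with [c n = (phi n + 1)^-1], and the proof works with the [M]-seminorm.
    Comments write [<u, v>] for [Mdot M u v] and [|u|] for [Mnorm M u].

    The choice of [phi] is what makes the residuals [x n - T (x n)] small.  It
    makes [x n.+1] the point of the segment from [x0] to [T (x n)] that is
    [M]-equidistant from [x n] and [T (x n)]; feeding this into nonexpansiveness
    at [x n] and [x n.+1] gives [phi n + 1 <= phi n.+1], hence
    [n + 1 <= phi n] ([PHA_phi_ge]).  Testing monotonicity of [I - T] against a
    fixed point then bounds the residual by a constant times [c n]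
    ([PHA_residual_le]).

    Convergence follows from [c n --> 0] and this bound on the residuals
    ([anchored_iteration_cvg]), in two regimes, because an adaptive [phi] may
    grow so fast that [c] is summable.

    - If [c] is summable, the steps [x n.+1 - x n] are [M]-summable, so [x] is
      [M]-Cauchy.
    - If [c] is not summable, the usual Halpern recursion
      [a n.+1 <= (1 - c n) * a n + c n * (2 * b n.+1)], with
      [a n = Mnorm M (x n - p) ^+ 2] and [b n = Mdot M (x0 - p) (x n - p)],
      forces [a n --> 0] as soon as the upper limit of [b] is at most [0].  The
      point [p] is the limit, for [lam] decreasing to [0], of the solutions of
      [z - T z = lam *: (x0 - z)].  Monotonicity of [I - T], used once between
      two such solutions and once between a solution and [x n], yields both the
      convergence to [p] ([resolvent_path_cvg]) and the upper limit of [b]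
      ([anchor_direction_limsup]).

    The seminorm alone cannot give limits in [H]: in general it is neither
    definite nor complete.  The Lipschitz hypothesis repairs this, since [T]
    maps [M]-Cauchy sequences to norm-Cauchy ones.  So in each regime it is
    [T (x n)] that is shown to converge in norm, and [x] follows because
    [c n --> 0]. *)

Set Implicit Arguments.
Unset Strict Implicit.
Unset Printing Implicit Defensive.

Local Open Scope classical_set_scope.
Local Open Scope ring_scope.

(** * Real sequences *)

Section RealSequences.
Context {R : realType}.

Lemma cvg_seq_cauchy (S : R^nat) : cvgn S ->
  forall e, 0 < e -> exists N, forall n, (N <= n)%N -> `|S n - S N| <= e.
Proof.
move=> /cvgrPdist_le S_cvg e e0.
have [N _ SN] := S_cvg (e / 2) (divr_gt0 e0 (ltr0Sn _ _)).
exists N => n Nn; have := SN N (leqnn N); have := SN n Nn => /=.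
move: (limn S) => l; rewrite !ler_norml => /andP[? ?] /andP[? ?].
by apply/andP; split; lra.
Qed.

(** As long as [a] stays above [e], the recursion with [e / 2] makes it drop by
    at least [c n * (e / 2)]; divergence of the series of [c] does not allow
    this forever.  Once [a] has been below [e], convexity keeps it there. *)
Lemma vanishing_recursion (a c : R^nat) :
  (forall n, 0 <= c n <= 1) -> ~ cvgn (series c) ->
  (forall e, 0 < e ->
    \forall n \near \oo, a n.+1 <= (1 - c n) * a n + c n * e) ->
  forall e, 0 < e -> \forall n \near \oo, a n <= e.
Proof.
move=> c01 c_dvg arec e e0.
have e2 : 0 < e / 2 by rewrite divr_gt0.
have [N _ aN] := arec _ e2.
have [k Nk ak] : exists2 k, (N <= k)%N & a k <= e.
  apply: contrapT => /forall2NP small; apply: c_dvg.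
  have a_gt k : (N <= k)%N -> e < a k.
    by case: (small k) => // /negP; rewrite -ltNge.
  apply: nondecreasing_is_cvgn.
    by apply: nondecreasing_series => n _ _; case/andP: (c01 n).
  have tail n : (N <= n)%N ->
      series c n * (e / 2) <= series c N * (e / 2) + a N - a n.
    elim: n => [|n IH]; first by rewrite leqn0 => /eqP ->; lra.
    rewrite leq_eqVlt => /predU1P[<-|Nn]; first by lra.
    rewrite seriesSr; have := IH Nn; have := aN n Nn; have := a_gt n Nn.
    have /andP[c0 _] := c01 n => /= h1 h2 h3.
    have : 0 <= c n * (a n - e) by rewrite mulr_ge0 // subr_ge0 ltW.
    lra.
  exists ((series c N * (e / 2) + a N) / (e / 2)) => _ [n _ <-].
  rewrite ler_pdivlMr//.
  have [Nn|/ltnW nN] := leqP N n.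
    by have := tail n Nn; have := a_gt n Nn; lra.
  apply: (@le_trans _ _ (series c N * (e / 2))).
    rewrite ler_pM2r//; apply: nondecreasing_series nN => m _ _.
    by case/andP: (c01 m).
  by rewrite lerDl ltW// (lt_trans e0)// a_gt.
exists k => // n /=; elim: n => [|n IH]; first by rewrite leqn0 => /eqP <-.
rewrite leq_eqVlt => /predU1P[<-//|kn].
apply: le_trans (aN n (leq_trans Nk kn)) _ => /=.
have /andP[c0 c1] := c01 n.
have : 0 <= (1 - c n) * (e - a n) by rewrite mulr_ge0 ?subr_ge0 ?IH.
have : 0 <= c n * (e / 2) by rewrite mulr_ge0// ltW.
lra.
Qed.

End RealSequences.

(** * The seminorm of a positive semidefinite operator *)

Section Seminorm.
Context {R : realType} {H : hilbertType R}.
Variable M : {linear H -> H}.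
Hypotheses (Msa : self_adjoint M) (Mpsd : positive_semidefinite M).
Implicit Types u v w z : H.

Lemma MdotC u v : Mdot M u v = Mdot M v u.
Proof.
rewrite /Mdot Msa.
by have := hermC (@inner R H) u (M v); rewrite expr0 mul1r.
Qed.

Lemma MdotDl u v w : Mdot M (u + v) w = Mdot M u w + Mdot M v w.
Proof. by rewrite /Mdot linearD linearDl. Qed.

Lemma MdotZl a u v : Mdot M (a *: u) v = a * Mdot M u v.
Proof. by rewrite /Mdot linearZ linearZl_LR. Qed.

Lemma MdotNl u v : Mdot M (- u) v = - Mdot M u v.
Proof. by rewrite -scaleN1r MdotZl mulN1r. Qed.

Lemma MdotDr u v w : Mdot M u (v + w) = Mdot M u v + Mdot M u w.
Proof. by rewrite MdotC MdotDl !(MdotC u). Qed.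

Lemma MdotZr a u v : Mdot M u (a *: v) = a * Mdot M u v.
Proof. by rewrite MdotC MdotZl (MdotC u). Qed.

Lemma MdotNr u v : Mdot M u (- v) = - Mdot M u v.
Proof. by rewrite MdotC MdotNl (MdotC u). Qed.

Definition MdotE := (MdotDl, MdotDr, MdotNl, MdotNr, MdotZl, MdotZr).

Lemma Mnorm_ge0 u : 0 <= Mnorm M u.
Proof. exact: sqrtr_ge0. Qed.

Lemma Mnorm0 : Mnorm M 0 = 0.
Proof. by rewrite /Mnorm /Mdot linear0r sqrtr0. Qed.

Lemma Mnorm_sqr u : Mnorm M u ^+ 2 = Mdot M u u.
Proof. by rewrite sqr_sqrtr //; exact: Mpsd. Qed.

(** Expanding [0 <= Mdot M w w] at [w = Mdot M v v *: u - Mdot M u v *: v] gives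
    the inequality multiplied by [Mdot M v v], and symmetrically in [u].  This
    leaves the case where both [u] and [v] are null vectors, in which
    [w = u + v] and [w = u - v] force [Mdot M u v = 0]. *)
Lemma Mdot_CS_sqr u v : Mdot M u v ^+ 2 <= Mdot M u u * Mdot M v v.
Proof.
have uu : 0 <= Mdot M u u by exact: Mpsd.
have vv : 0 <= Mdot M v v by exact: Mpsd.
have Qv : 0 <= Mdot M (Mdot M v v *: u - Mdot M u v *: v)
                      (Mdot M v v *: u - Mdot M u v *: v) by exact: Mpsd.
have Qu : 0 <= Mdot M (Mdot M u u *: v - Mdot M u v *: u)
                      (Mdot M u u *: v - Mdot M u v *: u) by exact: Mpsd.
have Qp : 0 <= Mdot M (u + v) (u + v) by exact: Mpsd.
have Qm : 0 <= Mdot M (u - v) (u - v) by exact: Mpsd.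
move: uu vv Qv Qu Qp Qm; rewrite !MdotE (MdotC v u).
move: (Mdot M u u) (Mdot M v v) (Mdot M u v) => a b c a0 b0 Qv Qu Qp Qm.
have {}Qv : 0 <= b * (a * b - c ^+ 2).
  by apply: le_trans Qv _; rewrite le_eqVlt; apply/orP; left; apply/eqP; ring.
have {}Qu : 0 <= a * (a * b - c ^+ 2).
  by apply: le_trans Qu _; rewrite le_eqVlt; apply/orP; left; apply/eqP; ring.
have [b1|b1] := ltP 0 b; first by rewrite -subr_ge0 -(pmulr_rge0 _ b1).
have [a1|a1] := ltP 0 a; first by rewrite -subr_ge0 -(pmulr_rge0 _ a1).
have c0 : c = 0 by lra.
by rewrite c0 expr0n mulr_ge0.
Qed.

Lemma Mdot_CS u v : Mdot M u v <= Mnorm M u * Mnorm M v.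
Proof.
rewrite -sqrtrM; last exact: Mpsd.
apply: le_trans (ler_norm _) _.
by rewrite -sqrtr_sqr ler_sqrt ?Mdot_CS_sqr// mulr_ge0 //; exact: Mpsd.
Qed.

Lemma ler_MnormD u v : Mnorm M (u + v) <= Mnorm M u + Mnorm M v.
Proof.
have h : 0 <= Mnorm M u + Mnorm M v by rewrite addr_ge0 ?Mnorm_ge0.
rewrite -(ler_pXn2r (ltn0Sn 1)) ?nnegrE ?Mnorm_ge0//.
rewrite sqrrD !Mnorm_sqr !MdotE (MdotC v u).
have := Mdot_CS u v; lra.
Qed.

Lemma MnormZ a u : Mnorm M (a *: u) = `|a| * Mnorm M u.
Proof. by rewrite /Mnorm !MdotE mulrA -expr2 sqrtrM ?sqr_ge0// sqrtr_sqr. Qed.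

Lemma MnormN u : Mnorm M (- u) = Mnorm M u.
Proof. by rewrite -scaleN1r MnormZ normrN1 mul1r. Qed.

Lemma MnormB u v : Mnorm M (u - v) = Mnorm M (v - u).
Proof. by rewrite -MnormN opprB. Qed.

Lemma ler_MnormB w u v : Mnorm M (u - v) <= Mnorm M (u - w) + Mnorm M (w - v).
Proof.
have -> : u - v = (u - w) + (w - v) by rewrite addrA subrK.
exact: ler_MnormD.
Qed.

End Seminorm.

(** * Nonexpansive operators that are Lipschitz from the seminorm to the norm *)

Section Operators.
Context {R : realType} {H : hilbertType R}.
Variables (M : {linear H -> H}) (T : H -> H) (L : R).
Hypotheses (Mbd : bounded_operator M) (Msa : self_adjoint M).
Hypothesis (Mpsd : positive_semidefinite M).
Hypotheses (Tne : Mnonexpansive M T) (Tlip : Mto_norm_lipschitz M L T).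
Implicit Types u v w z p : H.

(** The inner product of [H] is [Mdot] of the identity operator. *)
Lemma inner_CS u v : inner u v <= `|u| * `|v|.
Proof.
have h := @Mdot_CS R H idfun _ _ u v.
rewrite !norm_inner; apply: h => // w.
have [->|w0] := eqVneq w 0; first by rewrite linear0l.
by rewrite /= ltW// neq0_dnorm_gt0.
Qed.

Lemma Mnorm_le_norm : exists K : R, forall u, Mnorm M u <= K * `|u|.
Proof.
have [C MC] := Mbd; exists (Num.sqrt `|C|) => u.
rewrite -(ler_pXn2r (ltn0Sn 1)) ?nnegrE ?mulr_ge0 ?sqrtr_ge0//.
rewrite exprMn Mnorm_sqr// sqr_sqrtr//.
apply: le_trans (inner_CS _ _) _; rewrite expr2 mulrA ler_wpM2r//.
by apply: le_trans (MC u) _; rewrite ler_wpM2r// ler_norm.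
Qed.

Lemma Mnonexpansive_sqr u v :
  Mdot M (T u - T v) (T u - T v) <= Mdot M (u - v) (u - v).
Proof. by rewrite -!Mnorm_sqr// ler_pXn2r ?nnegrE ?Mnorm_ge0//; exact: Tne. Qed.

(** This is the identity
    [|g| ^ 2 - 2 * <g, u - v> = |T u - T v| ^ 2 - |u - v| ^ 2] for
    [g = (u - T u) - (v - T v)]: nonexpansiveness of [T] is cocoercivity of
    [I - T]. *)
Lemma Mdot_residual_ge u v :
  Mnorm M ((u - T u) - (v - T v)) ^+ 2 <=
  2 * Mdot M ((u - T u) - (v - T v)) (u - v).
Proof.
have := Mnonexpansive_sqr u v; rewrite Mnorm_sqr// !MdotE//.
rewrite !(MdotC Msa _ u) !(MdotC Msa _ v) (MdotC Msa (T v)).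
rewrite !(MdotC Msa v u).
lra.
Qed.

Lemma monotone_residual u v : 0 <= Mdot M ((u - T u) - (v - T v)) (u - v).
Proof.
have := Mdot_residual_ge u v.
by move/(le_trans (sqr_ge0 _)); rewrite pmulr_rge0.
Qed.

(** The constant [L] may be negative, in which case the seminorm vanishes
    everywhere; [`|L| + 1] is positive and serves in all cases, also as a divisor. *)
Lemma image_dist_le u v : `|T u - T v| <= (`|L| + 1) * Mnorm M (u - v).
Proof.
apply: le_trans (Tlip u v) _; rewrite ler_wpM2r ?Mnorm_ge0//.
by rewrite (le_trans (ler_norm L))// lerDl.
Qed.

Lemma cvg_image_Mnorm (y : H^nat) w :
  (forall e, 0 < e -> \forall n \near \oo, Mnorm M (y n - w) <= e) ->
  T (y n) @[n --> \oo] --> T w.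
Proof.
move=> yw; apply/cvgrPdist_le => e e0.
have L1 : 0 < `|L| + 1 by rewrite ltr_wpDl.
have := yw (e / (`|L| + 1)) (divr_gt0 e0 L1); apply: filterS => n yn.
rewrite distrC; apply: le_trans (image_dist_le _ _) _.
by rewrite mulrC -ler_pdivlMr.
Qed.

Lemma cvg_Mnorm (y : H^nat) w : y n @[n --> \oo] --> w ->
  forall e, 0 < e -> \forall n \near \oo, Mnorm M (y n - w) <= e.
Proof.
move=> yw e e0; have [K MK] := Mnorm_le_norm.
have K1 : 0 < `|K| + 1 by rewrite ltr_wpDl.
move/cvgrPdist_le : yw => /(_ (e / (`|K| + 1)) (divr_gt0 e0 K1)).
apply: filterS => n; rewrite distrC => yn.
apply: le_trans (MK _) _.
rewrite -(ler_pM2l K1) mulrCA divff ?gt_eqF// mulr1 in yn.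
apply: le_trans yn; rewrite ler_wpM2r//.
by rewrite (le_trans (ler_norm K))// lerDl.
Qed.

Lemma cvg_image (y : H^nat) w :
  y n @[n --> \oo] --> w -> T (y n) @[n --> \oo] --> T w.
Proof. by move=> yw; apply: cvg_image_Mnorm; exact: cvg_Mnorm. Qed.

(** The replacement for completeness of the seminorm: an [M]-Cauchy sequence has
    no limit of its own in general, its image under [T] has one. *)
Lemma cvg_image_Mcauchy (y : H^nat) :
  (forall e, 0 < e ->
    exists N, forall n, (N <= n)%N -> Mnorm M (y n - y N) <= e) ->
  cvgn (T \o y).
Proof.
move=> yC; apply/cauchy_cvgP/cauchy_exP => e e0.
have L1 : 0 < `|L| + 1 by rewrite ltr_wpDl.
have e2 : 0 < e / 2 by rewrite divr_gt0.
have [N yN] := yC _ (divr_gt0 e2 L1).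
exists (T (y N)); exists N => // n /= /yN {}yN.
rewrite -ball_normE /= distrC.
apply: le_lt_trans (image_dist_le _ _) _.
apply: (@le_lt_trans _ _ (e / 2)); first by rewrite mulrC -ler_pdivlMr.
by lra.
Qed.

Lemma cvg_image_summable (y : H^nat) (u : R^nat) :
  (forall n, Mnorm M (y n.+1 - y n) <= u n) -> cvgn (series u) ->
  cvgn (T \o y).
Proof.
move=> yu /cvg_seq_cauchy u_cvg; apply: cvg_image_Mcauchy => e /u_cvg[N uN].
exists N => n Nn; apply: le_trans (uN n Nn); apply: le_trans (ler_norm _).
elim: n Nn => [|n IH].
  by rewrite leqn0 => /eqP ->; rewrite !subrr Mnorm0.
rewrite leq_eqVlt => /predU1P[<-|/IH {}IH].
  by rewrite !subrr Mnorm0.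
rewrite seriesSr; have := ler_MnormB Msa Mpsd (y n) (y n.+1) (y N).
have := yu n; lra.
Qed.

Lemma anchored_limit x0 (y y' : H^nat) (c : R^nat) w :
  T (y n) @[n --> \oo] --> w -> c n @[n --> \oo] --> 0 ->
  (forall n, y' n = T (y n) + c n *: (x0 - T (y n))) ->
  y' n @[n --> \oo] --> w.
Proof.
move=> Tyw c0 y'E.
rewrite (_ : y' = fun n => T (y n) + c n *: (x0 - T (y n))); last first.
  by apply/funext.
rewrite -[w in _ --> w]addr0 -(scale0r (x0 - w)).
by apply: cvgD => //; apply: cvgZ => //; apply: cvgB => //; exact: cvg_cst.
Qed.

(** * The resolvent path of the anchor *)

(** The equation is the fixed point equation of
    [S u = (1 + lam)^-1 *: (lam *: x0 + T u)], a contraction for the seminorm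
    only.  Picard iterates [y] of [S] are [M]-Cauchy, so [T \o y] converges in
    norm, say to [w], and the solution is what [S] produces from [w]. *)
Lemma resolvent_exists x0 (lam : R) : 0 < lam ->
  exists z, z - T z = lam *: (x0 - z).
Proof.
move=> lam0; have l1 : 0 < 1 + lam by rewrite addr_gt0.
pose q := (1 + lam)^-1; have q0 : 0 < q by rewrite invr_gt0.
have q1 : q < 1 by rewrite invf_lt1// ltrDl.
pose S u := q *: (lam *: x0 + T u).
pose y n := iter n S x0.
have yu n : Mnorm M (y n.+1 - y n) <= geometric (Mnorm M (S x0 - x0)) q n.
  elim: n => [|n IH]; first by rewrite /= expr0 mulr1.
  rewrite /= -/(y n) -/(y n.+1) /S -scalerBr opprD addrACA subrr add0r.
  rewrite MnormZ// gtr0_norm// exprS mulrCA ler_pM2l//.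
  exact: le_trans (Tne _ _) IH.
have /cvg_ex[w Tyw] : cvgn (T \o y).
  apply: cvg_image_summable yu _; apply: is_cvg_geometric_series.
  by rewrite gtr0_norm.
exists (q *: (lam *: x0 + w)).
have Tw : T (q *: (lam *: x0 + w)) = w.
  have yz : y (n.+1) @[n --> \oo] --> q *: (lam *: x0 + w).
    by apply: cvgZr; apply: cvgD => //; exact: cvg_cst.
  apply: (cvg_unique (@norm_hausdorff _ _) (cvg_image yz)).
  by have := Tyw; rewrite -cvg_shiftS.
move: Tw; set z := q *: _ => ->.
have zE : z + lam *: z = lam *: x0 + w.
  by rewrite -{1}[z]scale1r -scalerDl scalerA divff ?gt_eqF// scale1r.
by apply/eqP; rewrite scalerBr subr_eq addrAC -zE addrK.
Qed.

(** Monotonicity of [I - T] between [z] and [p] says that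
    [<x0 - z, z - p> >= 0], that is
    [|x0 - z| ^ 2 <= <x0 - z, x0 - p>]; Cauchy-Schwarz concludes. *)
Lemma resolvent_bound x0 lam z p : T p = p -> 0 < lam ->
  z - T z = lam *: (x0 - z) -> Mnorm M (x0 - z) <= Mnorm M (x0 - p).
Proof.
move=> Tp lam0 zE.
have := monotone_residual z p.
rewrite zE Tp subrr subr0 MdotZl// pmulr_rge0//.
have -> : z - p = (x0 - p) - (x0 - z) by rewrite [RHS]addrC opprB addrA subrK.
rewrite MdotDr// MdotNr// -Mnorm_sqr// => h.
have [//|] := leP (Mnorm M (x0 - z)) (Mnorm M (x0 - p)).
have := Mdot_CS Msa Mpsd (x0 - z) (x0 - p).
have := Mnorm_ge0 M (x0 - p).
move: (Mnorm M (x0 - z)) (Mnorm M (x0 - p)) h => a b; nra.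
Qed.

(** With [a = x0 - z] and [b = x0 - w], monotonicity of [I - T] between [z] and
    [w] reads [0 <= <lam *: a - mu *: b, b - a>].  Together with
    [0 <= |b - a| ^ 2] this gives [0 <= (lam - mu) * (<a, b> - |a| ^ 2)], and
    [|a| ^ 2 <= <a, b>] amounts to the claim.  The squared distance to [x0] thus controls, along the path,
    the distance between any two of its points. *)
Lemma resolvent_dist x0 lam mu z w : 0 < mu -> mu < lam ->
  z - T z = lam *: (x0 - z) -> w - T w = mu *: (x0 - w) ->
  Mnorm M (z - w) ^+ 2 <= Mnorm M (x0 - w) ^+ 2 - Mnorm M (x0 - z) ^+ 2.
Proof.
move=> mu0 mulam zE wE; have := monotone_residual z w.
rewrite zE wE.
have -> : z - w = (x0 - w) - (x0 - z) by rewrite [RHS]addrC opprB addrA subrK.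
have : 0 <= Mnorm M ((x0 - w) - (x0 - z)) ^+ 2 by rewrite sqr_ge0.
move: (x0 - z) (x0 - w) => a b.
rewrite !Mnorm_sqr// !MdotE// !(MdotC Msa b a).
move: (Mdot M a a) (Mdot M a b) (Mdot M b b) => A c B D h.
suff : A <= c by lra.
have lm : 0 < lam - mu by rewrite subr_gt0.
rewrite -subr_ge0 -(pmulr_rge0 _ lm); nra.
Qed.

(** Along [lam n = n.+1%:R^-1] the squared distances of the solutions [z n] to
    [x0] increase by [resolvent_dist] and are bounded by [resolvent_bound]; they
    converge, so [z] is [M]-Cauchy by [resolvent_dist] again.  As
    [z n = T (z n) + n.+2%:R^-1 *: (x0 - T (z n))], the norm limit of
    [T (z n)] is that of [z n], hence a fixed point. *)
Lemma resolvent_path_cvg x0 : Fix T !=set0 ->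
  exists2 p, Fix T p & forall e, 0 < e -> exists lam z,
    [/\ 0 < lam, z - T z = lam *: (x0 - z) & Mnorm M (z - p) <= e].
Proof.
move=> [p0 Tp0].
pose lam (n : nat) : R := n.+1%:R^-1.
have lam0 n : 0 < lam n by rewrite invr_gt0.
have /choice[z zE] n := resolvent_exists x0 (lam0 n).
pose A n := Mnorm M (x0 - z n) ^+ 2.
have zz m n : (m <= n)%N -> Mnorm M (z m - z n) ^+ 2 <= A n - A m.
  rewrite leq_eqVlt => /predU1P[->|mn].
    by rewrite !subrr Mnorm0 expr0n.
  apply: (resolvent_dist (lam0 n) _ (zE m) (zE n)).
  by rewrite ltf_pV2 ?posrE// ltr_nat.
have A_cvg : cvgn A.
  apply: nondecreasing_is_cvgn.
    move=> m n mn; rewrite -subr_ge0.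
    by apply: le_trans (zz _ _ mn); exact: sqr_ge0.
  exists (Mnorm M (x0 - p0) ^+ 2) => _ [n _ <-].
  by rewrite ler_pXn2r ?nnegrE ?Mnorm_ge0// (resolvent_bound Tp0 (lam0 n)).
have /cvg_ex[p Tzp] : cvgn (T \o z).
  apply: cvg_image_Mcauchy => e e0.
  have [N AN] := cvg_seq_cauchy A_cvg (exprn_gt0 2 e0).
  exists N => n Nn.
  rewrite -(ler_pXn2r (ltn0Sn 1)) ?nnegrE ?Mnorm_ge0 ?(ltW e0)//.
  rewrite MnormB//; apply: le_trans (zz _ _ Nn) _.
  by apply: le_trans (ler_norm _) _; exact: AN.
have zp : z n @[n --> \oo] --> p.
  apply: (@anchored_limit x0 z z (fun n => n.+2%:R^-1) p Tzp).
    by rewrite (cvg_shiftS (@harmonic R)); exact: cvg_harmonic.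
  move=> n; apply: (scalerI (lt0r_neq0 (ltr0Sn R n.+1))).
  rewrite scalerDr scalerA divff ?gt_eqF// scale1r.
  have := congr1 (fun v => n.+1%:R *: v) (zE n) => /=.
  rewrite scalerA divff ?gt_eqF// scale1r scalerBr => /eqP.
  rewrite subr_eq => /eqP zn.
  rewrite -(natr1 n.+1) !scalerDl !scale1r zn [LHS]addrAC subrK.
  by rewrite -[RHS]addrA (addrC (T _)) subrK addrC.
exists p; first exact: (cvg_unique (@norm_hausdorff _ _) (cvg_image zp) Tzp).
move=> e e0; have [N _ zN] := cvg_Mnorm zp e0.
by exists (lam N), (z N); split => //; exact: zN (leqnn N).
Qed.

(** Monotonicity of [I - T] between [x n] and a point [z] of the resolvent path
    gives [lam * <x0 - z, x n - z> <= <x n - T (x n), x n - z>], whose right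
    side is small for large [n] once [z], hence [lam], is fixed.  Replacing [z] by
    [p] costs at most [Mnorm M (z - p)] times a constant. *)
Lemma anchor_direction_limsup x0 p (x : H^nat) B :
  Fix T p ->
  (forall e, 0 < e -> exists lam z,
    [/\ 0 < lam, z - T z = lam *: (x0 - z) & Mnorm M (z - p) <= e]) ->
  (forall n, Mnorm M (x n - p) <= B) ->
  (forall e, 0 < e -> \forall n \near \oo, Mnorm M (x n - T (x n)) <= e) ->
  forall e, 0 < e -> \forall n \near \oo, Mdot M (x0 - p) (x n - p) <= e.
Proof.
move=> Tp zp xB xr e e0.
have B0 : 0 <= B := le_trans (Mnorm_ge0 M _) (xB 0%N).
set C := Mnorm M (x0 - p).
have C0 : 0 <= C := Mnorm_ge0 M _.
have BC0 : 0 < 2 * (B + C + 1) by rewrite mulr_gt0// ltr_wpDl ?addr_ge0.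
have [lam [z [lam0 zE zd]]] := zp _ (divr_gt0 e0 BC0).
move: zd; set d := e / _ => zd.
have d0 : 0 < d by rewrite divr_gt0.
have Bd : 0 < 2 * (B + d) by rewrite mulr_gt0// ltr_wpDl.
have := xr (lam * (e / (2 * (B + d)))) (mulr_gt0 lam0 (divr_gt0 e0 Bd)).
apply: filterS => n rn.
have split_p : Mdot M (x0 - p) (x n - p) =
    Mdot M (x0 - z) (x n - z) + Mdot M (x0 - z) (z - p) +
    Mdot M (z - p) (x n - p).
  have -> : x n - z = (x n - p) - (z - p) by rewrite opprB addrA subrK.
  have -> : x0 - z = (x0 - p) - (z - p) by rewrite opprB addrA subrK.
  move: (x0 - p) (x n - p) (z - p) => a b c; rewrite !MdotE//; ring.
have z1 : Mdot M (x0 - z) (x n - z) <= e / 2.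
  have := monotone_residual (x n) z; rewrite zE MdotDl// MdotNl// MdotZl//.
  have := Mdot_CS Msa Mpsd (x n - T (x n)) (x n - z).
  have xz : Mnorm M (x n - z) <= B + d.
    apply: le_trans (ler_MnormB Msa Mpsd p _ _) _; rewrite lerD//.
    by rewrite MnormB.
  have := ler_pM (Mnorm_ge0 M _) (Mnorm_ge0 M _) rn xz.
  have -> : lam * (e / (2 * (B + d))) * (B + d) = lam * (e / 2).
    field; rewrite gt_eqF//; lra.
  move=> h1 h2 h3; rewrite -(ler_pM2l lam0); lra.
have z2 : Mdot M (x0 - z) (z - p) <= C * d.
  apply: le_trans (Mdot_CS Msa Mpsd _ _) _.
  by apply: ler_pM; rewrite ?Mnorm_ge0// (resolvent_bound Tp lam0 zE).
have z3 : Mdot M (z - p) (x n - p) <= d * B.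
  apply: le_trans (Mdot_CS Msa Mpsd _ _) _.
  by apply: ler_pM; rewrite ?Mnorm_ge0.
have dE : d * (2 * (B + C + 1)) = e by rewrite divfK// gt_eqF.
rewrite split_p; nra.
Qed.

(** * One anchored step *)

Lemma anchored_stepB x0 u v p (c : R) : v = T u + c *: (x0 - T u) ->
  v - p = (1 - c) *: (T u - p) + c *: (x0 - p).
Proof.
move=> ->.
have -> : x0 - T u = (x0 - p) - (T u - p) by rewrite opprB addrA subrK.
rewrite [LHS]addrAC; move: (x0 - p) (T u - p) => a t.
by rewrite scalerBr scalerBl scale1r addrA [LHS]addrAC.
Qed.

(** After expansion the difference of the two sides is
    [(1 - c) * (|u - p| ^ 2 - |T u - p| ^ 2) + c * (1 - c) * |T u - p| ^ 2
    + c ^ 2 * |x0 - p| ^ 2]. *)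
Lemma anchored_step_sqr x0 u v p c : Fix T p -> 0 <= c <= 1 ->
  v = T u + c *: (x0 - T u) ->
  Mnorm M (v - p) ^+ 2 <=
  (1 - c) * Mnorm M (u - p) ^+ 2 + c * (2 * Mdot M (x0 - p) (v - p)).
Proof.
move=> Tp /andP[c0 c1] vE.
have : Mnorm M (T u - p) ^+ 2 <= Mnorm M (u - p) ^+ 2.
  rewrite ler_pXn2r ?nnegrE ?Mnorm_ge0//.
  by have := Tne u p; rewrite [T p]Tp.
move: (Mnorm M (u - p) ^+ 2) => U tU.
rewrite (anchored_stepB p vE).
move: tU; rewrite !Mnorm_sqr//.
have := Mpsd (x0 - p); have := Mpsd (T u - p); rewrite -!/(Mdot M _ _).
move: (x0 - p) (T u - p) => a t; rewrite !MdotE// (MdotC Msa a t).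
move: (Mdot M a a) (Mdot M t t) (Mdot M t a) => A D E D0 A0 DU.
have : 0 <= c * (1 - c) * D by rewrite !mulr_ge0// subr_ge0.
have : 0 <= c ^+ 2 * A by rewrite mulr_ge0 ?sqr_ge0.
have : 0 <= (1 - c) * (U - D) by rewrite mulr_ge0 // subr_ge0.
lra.
Qed.

Lemma anchored_step_bound x0 u v p c : Fix T p -> 0 <= c <= 1 ->
  v = T u + c *: (x0 - T u) -> Mnorm M (u - p) <= Mnorm M (x0 - p) ->
  Mnorm M (v - p) <= Mnorm M (x0 - p).
Proof.
move=> Tp /andP[c0 c1] vE uB.
rewrite (anchored_stepB p vE).
apply: le_trans (ler_MnormD Msa Mpsd _ _) _.
rewrite !MnormZ// !ger0_norm ?subr_ge0//.
have : Mnorm M (T u - p) <= Mnorm M (x0 - p).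
  by apply: le_trans uB; have := Tne u p; rewrite [T p]Tp.
move=> h; have : 0 <= (1 - c) * (Mnorm M (x0 - p) - Mnorm M (T u - p)).
  by rewrite mulr_ge0 ?subr_ge0.
lra.
Qed.

(** The equation on [f] is the one that defines [PHA_phi].  It is equivalent to
    [|u - T u| ^ 2 = 2 * <u - T u, u - v>], that is, to [v] being equidistant
    from [u] and [T u]: then [|T v - T u| <= |v - u| = |v - T u|], and squaring
    out [T v - T u = (v - T u) - (v - T v)] gives the conclusion, because
    [x0 - v = f *: (v - T u)].  The conclusion in turn bounds the value of
    [PHA_phi] at [v] from below by [f + 1]. *)
Lemma average_residual_le x0 u v (f : R) : 0 < f ->
  f * Mnorm M (u - T u) ^+ 2 =
    2 * Mdot M (u - T u) (x0 - u) + Mnorm M (u - T u) ^+ 2 ->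
  x0 - T u = (f + 1) *: (v - T u) ->
  f * Mnorm M (v - T v) ^+ 2 <= 2 * Mdot M (v - T v) (x0 - v).
Proof.
move=> f0 fE x0E; have f1 : 0 < f + 1 by rewrite addr_gt0.
have uE : x0 - u = (f + 1) *: (v - T u) - (u - T u).
  by rewrite -x0E opprB addrA subrK.
have vE : x0 - v = f *: (v - T u).
  by rewrite -[f in RHS](addrK 1) scalerBl scale1r -x0E opprB addrA subrK.
have balance : Mdot M (u - T u) (u - T u) = 2 * Mdot M (u - T u) (u - v).
  apply: (mulfI (lt0r_neq0 f1)); move: fE.
  rewrite uE Mnorm_sqr// !MdotE// !(MdotC Msa (T u) u).
  lra.
rewrite vE Mnorm_sqr// MdotZr// mulrCA ler_pM2l//.
have := Mnonexpansive_sqr v u; move: balance; rewrite !MdotE//.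
rewrite !(MdotC Msa _ u) !(MdotC Msa _ v) !(MdotC Msa (T v)) !(MdotC Msa v u).
lra.
Qed.

End Operators.

(** * Anchored iterations with small residuals *)

Section AnchoredIteration.
Context {R : realType} {H : hilbertType R}.
Variables (M : {linear H -> H}) (T : H -> H) (L : R).
Hypotheses (Mbd : bounded_operator M) (Msa : self_adjoint M).
Hypothesis (Mpsd : positive_semidefinite M).
Hypotheses (Tne : Mnonexpansive M T) (Tlip : Mto_norm_lipschitz M L T).
Variables (x : H^nat) (c : R^nat) (K : R).
Hypothesis c01 : forall n, 0 <= c n <= 1.
Hypothesis xE : forall n, x n.+1 = T (x n) + c n *: (x 0%N - T (x n)).
Hypothesis res_le : forall n, Mnorm M (x n - T (x n)) <= K * c n.

Lemma anchored_bound p n : Fix T p ->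
  Mnorm M (x n - p) <= Mnorm M (x 0%N - p).
Proof.
move=> Tp; elim: n => [//|n IH].
exact: (anchored_step_bound Msa Mpsd Tne Tp (c01 n) (xE n) IH).
Qed.

Lemma anchored_cvg_image_summable : Fix T !=set0 -> cvgn (series c) ->
  cvgn (T \o x).
Proof.
move=> [p Tp] c_sum; set C := Mnorm M (x 0%N - p).
apply: (cvg_image_summable Msa Mpsd Tlip (u := (2 * C + K) *: c)); last first.
  exact: is_cvg_seriesZ.
move=> n; have /andP[c0 _] := c01 n.
apply: le_trans (ler_MnormB Msa Mpsd (T (x n)) _ _) _.
rewrite {1}xE [T _ + _]addrC addrK MnormZ// ger0_norm//.
have x0Tx : Mnorm M (x 0%N - T (x n)) <= 2 * C.
  apply: le_trans (ler_MnormB Msa Mpsd p _ _) _.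
  have : Mnorm M (p - T (x n)) <= C.
    apply: le_trans (anchored_bound n Tp); rewrite MnormB//.
    by have := Tne (x n) p; rewrite [T p]Tp.
  rewrite -/C; lra.
have := ler_wpM2l c0 x0Tx; have := res_le n; rewrite MnormB//= => h1 h2.
rewrite [leRHS](_ : _ = (2 * C + K) * c n)//; lra.
Qed.

Lemma anchored_residual_cvg0 : c n @[n --> \oo] --> 0 ->
  forall e, 0 < e -> \forall n \near \oo, Mnorm M (x n - T (x n)) <= e.
Proof.
move=> c_cvg0 e e0; have K1 : 0 < `|K| + 1 by rewrite ltr_wpDl.
move/cvgrPdist_le : c_cvg0 => /(_ _ (divr_gt0 e0 K1)).
apply: filterS => n; rewrite sub0r normrN => cn.
apply: le_trans (res_le n) _.
have := le_trans (ler_norm _) cn; rewrite ler_pdivlMr// => h.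
have /andP[c0 _] := c01 n.
by have := ler_wpM2r c0 (ler_norm K); lra.
Qed.

Lemma anchored_cvg_image_divergent : Fix T !=set0 ->
  c n @[n --> \oo] --> 0 -> ~ cvgn (series c) -> cvgn (T \o x).
Proof.
move=> Fix0 c_cvg0 c_dvg.
have [p Tp p_path] := resolvent_path_cvg Mbd Msa Mpsd Tne Tlip (x 0%N) Fix0.
have b_limsup := anchor_direction_limsup Msa Mpsd Tne Tp p_path
  (fun n => anchored_bound n Tp) (anchored_residual_cvg0 c_cvg0).
pose a n := Mnorm M (x n - p) ^+ 2.
have a_rec d : 0 < d ->
    \forall n \near \oo, a n.+1 <= (1 - c n) * a n + c n * d.
  move=> d0; have [N _ xN] := b_limsup (d / 2) (divr_gt0 d0 (ltr0Sn _ _)).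
  exists N => // n Nn /=; have /andP[c0 _] := c01 n.
  apply: le_trans (anchored_step_sqr Msa Mpsd Tne Tp (c01 n) (xE n)) _.
  rewrite lerD2l ler_wpM2l//.
  by have := xN n.+1 (leqW Nn) => /=; lra.
apply/cvg_ex; exists (T p).
apply: (cvg_image_Mnorm (M := M) (L := L)) => // e e0.
apply: filterS (vanishing_recursion c01 c_dvg a_rec (exprn_gt0 2 e0)) => n.
by rewrite ler_pXn2r// nnegrE ?Mnorm_ge0//; exact: ltW.
Qed.

Theorem anchored_iteration_cvg : Fix T !=set0 -> c n @[n --> \oo] --> 0 ->
  exists2 p, Fix T p & x n @[n --> \oo] --> p.
Proof.
move=> Fix0 c_cvg0.
have /cvg_ex[q Txq] : cvgn (T \o x).
  have [c_sum|c_dvg] := pselect (cvgn (series c)).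
    exact: anchored_cvg_image_summable.
  exact: anchored_cvg_image_divergent.
have xq : x n.+1 @[n --> \oo] --> q := anchored_limit Txq c_cvg0 xE.
rewrite cvg_shiftS in xq; exists q => //.
have Tq := cvg_image Mbd Mpsd Tlip xq.
exact: (cvg_unique (@norm_hausdorff _ _) Tq Txq).
Qed.

End AnchoredIteration.

(** * Adaptive anchoring parameters *)

Section PHA.
Context {R : realType} {H : hilbertType R}.
Variables (M : {linear H -> H}) (T : H -> H) (x0 : H) (x : H^nat).
Hypotheses (Msa : self_adjoint M) (Mpsd : positive_semidefinite M).
Hypothesis Tne : Mnonexpansive M T.
Hypothesis x_PHA : PHA_sequence M T x0 x.
Hypothesis res_neq0 :
  forall k, (1 <= k)%N -> Mnorm M (x k.-1 - T (x k.-1)) != 0.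

(** The shift makes [phi n] the parameter computed from [x n], the one used in
    the step from [x n] to [x n.+1]. *)
Let phi n := PHA_phi M T x n.+1.

Lemma PHA_phiE n : phi n * Mnorm M (x n - T (x n)) ^+ 2 =
  2 * Mdot M (x n - T (x n)) (x0 - x n) + Mnorm M (x n - T (x n)) ^+ 2.
Proof.
rewrite /phi /PHA_phi /= x_PHA.1 mulrDl mul1r divfK//.
by rewrite expf_neq0//; exact: (res_neq0 (ltn0Sn n)).
Qed.

Lemma PHA_stepE n : 0 < phi n ->
  x n.+1 = T (x n) + (phi n + 1)^-1 *: (x0 - T (x n)).
Proof.
move=> phi0; have := x_PHA.2 n.+1 (ltn0Sn n); rewrite /= -/(phi n) => ->.
rewrite div1r scalerBr addrCA; congr (_ + _).
rewrite -[X in X - _]scale1r -scalerBl; congr (_ *: _).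
by field; rewrite gt_eqF// addr_gt0.
Qed.

(** The parameter starts at [1], because [x 0%N] is the anchor, and grows by at
    least [1] in each step by [average_residual_le]. *)
Lemma PHA_phi_ge n : n.+1%:R <= phi n.
Proof.
elim: n => [|n IH].
  by rewrite /phi /PHA_phi /= subrr /Mdot linear0r mulr0 mul0r add0r.
have phi0 : 0 < phi n by apply: lt_le_trans IH.
have phi1 : 0 < phi n + 1 by rewrite addr_gt0.
have stepE : x0 - T (x n) = (phi n + 1) *: (x n.+1 - T (x n)).
  by rewrite PHA_stepE// [T _ + _]addrC addrK scalerA divff ?scale1r// gt_eqF.
have := average_residual_le Msa Mpsd Tne phi0 (PHA_phiE n) stepE.
set r := x n.+1 - _ => h; have := PHA_phiE n.+1; rewrite -/r => hE.
have r0 : 0 < Mnorm M r ^+ 2.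
  by rewrite exprn_gt0// lt0r Mnorm_ge0 andbT (res_neq0 (ltn0Sn n.+1)).
rewrite -natr1; apply: (@le_trans _ _ (phi n + 1)); first by rewrite lerD2r.
by rewrite -(ler_pM2r r0) mulrDl mul1r hE lerD2r.
Qed.

Lemma PHA_phi_gt0 n : 0 < phi n.
Proof. exact: lt_le_trans (PHA_phi_ge n). Qed.

Lemma PHA_weight01 n : 0 <= (phi n + 1)^-1 <= 1.
Proof.
have phi0 := PHA_phi_gt0 n.
have phi1 : 0 < phi n + 1 by rewrite addr_gt0.
by rewrite invr_ge0 ltW//= invf_le1// lerDr ltW.
Qed.

Lemma PHA_weight_cvg0 : (phi n + 1)^-1 @[n --> \oo] --> 0.
Proof.
apply: (@squeeze_cvgr _ _ _ _ (fun=> 0) (@harmonic R)).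
- exists 0%N => // n _ /=; have /andP[-> _] := PHA_weight01 n.
  have phi1 : 0 < phi n + 1 := addr_gt0 (PHA_phi_gt0 n) ltr01.
  by rewrite /= lef_pV2 ?posrE// (le_trans (PHA_phi_ge n))// lerDl.
- exact: cvg_cst.
- exact: cvg_harmonic.
Qed.

(** With [r = x n - T (x n)], the definition of [phi] computes
    [2 * <r, x0 - x n>] and cocoercivity at [p] gives
    [|r| ^ 2 <= 2 * <r, x n - p>]; the sum is
    [phi n * |r| ^ 2 <= 2 * <r, x0 - p>]. *)
Lemma PHA_residual_le p n : Fix T p ->
  phi n * Mnorm M (x n - T (x n)) <= 2 * Mnorm M (x0 - p).
Proof.
move=> Tp; have phiE := PHA_phiE n.
have := Mdot_residual_ge Msa Mpsd Tne (x n) p; rewrite [T p]Tp subrr subr0.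
move: phiE; have r0 := res_neq0 (ltn0Sn n); move: r0 => /=.
set r := x n - T (x n) => r0 phiE h.
have {r0} r0 : 0 < Mnorm M r by rewrite lt0r r0 Mnorm_ge0.
have x0E : x0 - p = (x0 - x n) + (x n - p) by rewrite addrA subrK.
have := Mdot_CS Msa Mpsd r (x0 - p); rewrite {1}x0E MdotDr//.
move=> cs; rewrite -(ler_pM2r r0) -!mulrA -expr2 (mulrC _ (Mnorm M r)).
lra.
Qed.

Lemma PHA_residual_le_weight p n : Fix T p ->
  Mnorm M (x n - T (x n)) <= 4 * Mnorm M (x0 - p) * (phi n + 1)^-1.
Proof.
move=> Tp; have phi1 : 0 < phi n + 1 := addr_gt0 (PHA_phi_gt0 n) ltr01.
rewrite ler_pdivlMr//; have := PHA_residual_le n Tp; have := PHA_phi_ge n.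
have : (1 : R) <= n.+1%:R by rewrite ler1n.
have := Mnorm_ge0 M (x n - T (x n)).
(* The factor 4 absorbs [phi n + 1 <= 2 * phi n]. *)
move: (Mnorm M _) (phi n) => r f r0 n1 fn fr; nra.
Qed.

End PHA.

Theorem theorem3p1 (R : realType) (H : hilbertType R)
    (M : {linear H -> H}) (T : H -> H) (L : R) (x0 : H) (x : H^nat) :
  bounded_operator M -> self_adjoint M -> positive_semidefinite M ->
  Mnonexpansive M T -> Mto_norm_lipschitz M L T ->
  Fix T !=set0 -> closed (Fix T) ->
  convex_set (Fix T : set (convex_lmodType H)) ->
  PHA_sequence M T x0 x ->
  (forall k, (1 <= k)%N -> Mnorm M (x k.-1 - T (x k.-1)) != 0) ->
  weak_cluster_set x `<=` Fix T ->
  exists2 p, Fix T p & x @ \oo --> p.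
Proof.
move=> Mbd Msa Mpsd Tne Tlip Fix0 _ _ x_PHA res_neq0 _.
have [p Tp] := Fix0.
apply: (anchored_iteration_cvg Mbd Msa Mpsd Tne Tlip
  (c := fun n => (PHA_phi M T x n.+1 + 1)^-1)
  (K := 4 * Mnorm M (x0 - p))) => // [n|n|n|].
- exact: (PHA_weight01 Msa Mpsd Tne x_PHA res_neq0).
- rewrite x_PHA.1; apply: (PHA_stepE x_PHA).
  exact: (PHA_phi_gt0 Msa Mpsd Tne x_PHA res_neq0).
- exact: (PHA_residual_le_weight Msa Mpsd Tne x_PHA res_neq0).
- exact: (PHA_weight_cvg0 Msa Mpsd Tne x_PHA res_neq0).
Qed.
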